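(* The stable category $\underline{\mathbf{Preord}}$ is a pointed category, that is, it has a zero object. Moreover, every trivial object of $\mathbf{Preord}$ becomes a zero object in $\underline{\mathbf{Preord}}$.
   Context: $\mathbf{Preord}$ is the category whose objects are pairs $(A,\rho)$ with $A$ a non-empty set and $\rho$ a preorder (reflexive, transitive relation) on $A$, and whose morphisms are the preorder-preserving maps. A trivial object is an object $(B,=)$ with $=$ the equality relation; a morphism is trivial if it factors through a trivial object. A subset $B$ of a preordered set $(A,\rho)$ is clopen if for every $a\in A\setminus B$ and $b\in B$ neither $a\rho b$ nor $b\rho a$ holds. For objects $(A,\rho),(A',\rho')$, define a relation $R_{A,A'}$ on $\mathrm{Hom}(A,A')$ by: $f\,R_{A,A'}\,g$ if there is a clopen subset $B$ of $A$ such that $f|_B$ and $g|_B$ are trivial morphisms (with $B$ carrying the induced preorder) and $f|_{A\setminus B}=g|_{A\setminus B}$. ($B$ or $A\setminus B$ may be empty, and the condition on the restriction to the empty set is then vacuous.) This is a congruence on $\mathbf{Preord}$, and the stable category $\underline{\mathbf{Preord}}:=\mathbf{Preord}/R$ is the quotient category: it has the same objects as $\mathbf{Preord}$, and $\mathrm{Hom}_{\underline{\mathbf{Preord}}}(A,A')=\mathrm{Hom}_{\mathbf{Preord}}(A,A')/R_{A,A'}$. *)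

(* Defs.v *)
From Stdlib Require Import RelationClasses Classical.
From Stdlib Require Import FunctionalExtensionality PropExtensionality ProofIrrelevance.

Set Implicit Arguments.
Unset Strict Implicit.
Unset Printing Implicit Defensive.

(** * Categories *)

Record Category := MkCategory {
  Ob :> Type;
  Hom : Ob -> Ob -> Type;
  idm : forall X : Ob, Hom X X;
  comp : forall X Y Z : Ob, Hom Y Z -> Hom X Y -> Hom X Z;
  comp_idl : forall (X Y : Ob) (f : Hom X Y), comp (idm Y) f = f;
  comp_idr : forall (X Y : Ob) (f : Hom X Y), comp f (idm X) = f;
  comp_assoc : forall (X Y Z W : Ob) (h : Hom Z W) (g : Hom Y Z) (f : Hom X Y),
    comp h (comp g f) = comp (comp h g) f
}.

Arguments Hom {c} X Y.
Arguments idm {c} X.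
Arguments comp {c X Y Z} g f.

Definition initial_object (C : Category) (Z : C) : Prop :=
  forall X : C, exists! f : Hom Z X, True.

Definition terminal_object (C : Category) (Z : C) : Prop :=
  forall X : C, exists! f : Hom X Z, True.

Definition zero_object (C : Category) (Z : C) : Prop :=
  initial_object Z /\ terminal_object Z.

Definition pointed (C : Category) : Prop := exists Z : C, zero_object Z.

(** * Quotient of a category by a congruence *)

Record congruence (C : Category)
    (R : forall X Y : C, Hom X Y -> Hom X Y -> Prop) : Prop := MkCongruence {
  cong_equiv : forall X Y : C, Equivalence (@R X Y);
  cong_comp : forall (X Y Z : C) (g g' : Hom Y Z) (f f' : Hom X Y),
    R Y Z g g' -> R X Y f f' -> R X Z (comp g f) (comp g' f')
}.

(** The set of [R]-classes of [T]; equality of classes is Leibniz equality. *)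
Definition quot (T : Type) (R : T -> T -> Prop) : Type :=
  {P : T -> Prop | exists f : T, P = R f}.

Definition cls (T : Type) (R : T -> T -> Prop) (f : T) : quot R :=
  exist _ (R f) (ex_intro _ f eq_refl).

Lemma quot_surj (T : Type) (R : T -> T -> Prop) (F : quot R) :
  exists f : T, F = cls R f.
Proof.
destruct F as [P [f HP]]; exists f; subst P; reflexivity.
Qed.

Lemma cls_eq (T : Type) (R : T -> T -> Prop) (f g : T) :
  Equivalence R -> cls R f = cls R g <-> R f g.
Proof.
intros [rf sy tr]; split.
- intros H; apply (f_equal (@proj1_sig _ _)) in H; simpl in H.
  rewrite H; apply rf.
- intros H; apply subset_eq_compat; extensionality h.
  apply propositional_extensionality; split; intros K.
  + exact (tr _ _ _ (sy _ _ H) K).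
  + exact (tr _ _ _ H K).
Qed.

Section Quotient.
Context (C : Category) (R : forall X Y : C, Hom X Y -> Hom X Y -> Prop).
Context (HR : congruence R).

Definition qcomp_set (X Y Z : C) (G : quot (@R Y Z)) (F : quot (@R X Y)) :
    Hom X Z -> Prop :=
  fun h => exists g f, proj1_sig G g /\ proj1_sig F f /\ R (comp g f) h.

Lemma qcomp_cls (X Y Z : C) (g : Hom Y Z) (f : Hom X Y) :
  qcomp_set (cls (@R Y Z) g) (cls (@R X Y) f) = R (comp g f).
Proof.
extensionality h; apply propositional_extensionality.
destruct (cong_equiv HR X Z) as [rf sy tr].
split.
- intros [g' [f' [Hg [Hf H]]]]; simpl in Hg, Hf.
  exact (tr _ _ _ (cong_comp HR Hg Hf) H).
- intros H; exists g, f; simpl; split; [|split; [|exact H]].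
  + apply (cong_equiv HR).
  + apply (cong_equiv HR).
Qed.

Lemma qcomp_subproof (X Y Z : C) (G : quot (@R Y Z)) (F : quot (@R X Y)) :
  exists h : Hom X Z, qcomp_set G F = R h.
Proof.
destruct (quot_surj G) as [g ->]; destruct (quot_surj F) as [f ->].
exists (comp g f); apply qcomp_cls.
Qed.

Definition qcomp (X Y Z : C) (G : quot (@R Y Z)) (F : quot (@R X Y)) :
    quot (@R X Z) :=
  exist _ (qcomp_set G F) (qcomp_subproof G F).

Lemma qcompE (X Y Z : C) (g : Hom Y Z) (f : Hom X Y) :
  qcomp (cls (@R Y Z) g) (cls (@R X Y) f) = cls (@R X Z) (comp g f).
Proof. apply subset_eq_compat; apply qcomp_cls. Qed.

Lemma qcomp_idl (X Y : C) (F : quot (@R X Y)) :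
  qcomp (cls (@R Y Y) (idm Y)) F = F.
Proof. destruct (quot_surj F) as [f ->]; now rewrite qcompE, comp_idl. Qed.

Lemma qcomp_idr (X Y : C) (F : quot (@R X Y)) :
  qcomp F (cls (@R X X) (idm X)) = F.
Proof. destruct (quot_surj F) as [f ->]; now rewrite qcompE, comp_idr. Qed.

Lemma qcomp_assoc (X Y Z W : C) (H : quot (@R Z W)) (G : quot (@R Y Z))
    (F : quot (@R X Y)) :
  qcomp H (qcomp G F) = qcomp (qcomp H G) F.
Proof.
destruct (quot_surj F) as [f ->]; destruct (quot_surj G) as [g ->].
destruct (quot_surj H) as [h ->].
now rewrite !qcompE, comp_assoc.
Qed.

Definition Quotient : Category :=
  @MkCategory (Ob C) (fun X Y => quot (@R X Y))
    (fun X => cls (@R X X) (idm X)) qcomp qcomp_idl qcomp_idr qcomp_assoc.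

End Quotient.

(** * Preordered sets *)

Record PreordSet := MkPreordSet {
  carrier :> Type;
  prel : carrier -> carrier -> Prop;
  prel_preorder : PreOrder prel;
  carrier_nonempty : inhabited carrier
}.

Arguments prel {p} x y.

Record PreordMap (A A' : PreordSet) := MkPreordMap {
  pmap :> A -> A';
  pmap_mono : forall x y : A, prel x y -> prel (pmap x) (pmap y)
}.

Lemma PreordMap_eq (A A' : PreordSet) (f g : PreordMap A A') :
  (forall x, f x = g x) -> f = g.
Proof.
destruct f as [f Hf], g as [g Hg]; simpl; intros H.
assert (E : f = g) by (extensionality x; apply H).
subst g; f_equal; apply proof_irrelevance.
Qed.

Definition pid (A : PreordSet) : PreordMap A A :=
  @MkPreordMap A A (fun x => x) (fun x y h => h).

Definition pcomp (A B D : PreordSet) (g : PreordMap B D) (f : PreordMap A B) :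
    PreordMap A D :=
  @MkPreordMap A D (fun x => g (f x))
    (fun x y h => pmap_mono g (pmap_mono f h)).

Lemma pcomp_idl (A B : PreordSet) (f : PreordMap A B) : pcomp (pid B) f = f.
Proof. apply PreordMap_eq; reflexivity. Qed.

Lemma pcomp_idr (A B : PreordSet) (f : PreordMap A B) : pcomp f (pid A) = f.
Proof. apply PreordMap_eq; reflexivity. Qed.

Lemma pcomp_assoc (A B D E : PreordSet) (h : PreordMap D E)
    (g : PreordMap B D) (f : PreordMap A B) :
  pcomp h (pcomp g f) = pcomp (pcomp h g) f.
Proof. apply PreordMap_eq; reflexivity. Qed.

Definition Preord : Category :=
  @MkCategory PreordSet PreordMap pid pcomp pcomp_idl pcomp_idr pcomp_assoc.

Definition trivial_object (B : PreordSet) : Prop :=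
  forall x y : B, prel x y <-> x = y.

Definition trivial_morphism (A A' : PreordSet) (f : PreordMap A A') : Prop :=
  exists (T : PreordSet) (k : PreordMap A T) (h : PreordMap T A'),
    trivial_object T /\ f = pcomp h k.

Definition clopen (A : PreordSet) (B : A -> Prop) : Prop :=
  forall a b : A, ~ B a -> B b -> ~ prel a b /\ ~ prel b a.

(** ** Restriction to a non-empty subset *)

Lemma sub_preorder (A : PreordSet) (B : A -> Prop) :
  PreOrder (fun x y : {a : A | B a} => prel (proj1_sig x) (proj1_sig y)).
Proof.
destruct (prel_preorder A) as [rf tr]; split.
- intros x; apply rf.
- intros x y z; apply tr.
Qed.

Lemma sub_nonempty (A : PreordSet) (B : A -> Prop) :
  (exists a, B a) -> inhabited {a : A | B a}.
Proof. intros [a Ha]; exact (inhabits (exist _ a Ha)). Qed.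

Definition sub (A : PreordSet) (B : A -> Prop) (hB : exists a, B a) : PreordSet :=
  MkPreordSet (sub_preorder B) (sub_nonempty hB).

Definition restrict (A A' : PreordSet) (f : PreordMap A A') (B : A -> Prop)
    (hB : exists a, B a) : PreordMap (sub hB) A' :=
  @MkPreordMap (sub hB) A' (fun x => f (proj1_sig x))
    (fun x y h => pmap_mono f h).

(** Vacuous for empty [B], which does not carry an object of [Preord]. *)
Definition trivial_on (A A' : PreordSet) (B : A -> Prop) (f : PreordMap A A') :
    Prop :=
  forall hB : exists a, B a, trivial_morphism (restrict f hB).

(** * The stable category *)

Definition stable_rel (A A' : PreordSet) (f g : PreordMap A A') : Prop :=
  exists B : A -> Prop,
    clopen B /\ trivial_on B f /\ trivial_on B g /\
    (forall a : A, ~ B a -> f a = g a).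

Lemma eq_preorder (T : Type) : PreOrder (@eq T).
Proof. split; [exact (@eq_refl T) | exact (@eq_trans T)]. Qed.

Definition discrete (T : Type) (hT : inhabited T) : PreordSet :=
  MkPreordSet (eq_preorder T) hT.

Lemma trivial_morphismP (A A' : PreordSet) (f : PreordMap A A') :
  trivial_morphism f <-> (forall x y : A, prel x y -> f x = f y).
Proof.
split.
- intros [T [k [h [HT ->]]]] x y Hxy; simpl; f_equal.
  apply HT; exact (pmap_mono k Hxy).
- intros H.
  set (T := discrete (carrier_nonempty A')).
  assert (hm : forall x y : T, prel x y -> @prel A' x y).
  { intros x y Hxy; simpl in Hxy; rewrite Hxy; apply (prel_preorder A'). }
  exists T, (@MkPreordMap A T f H), (@MkPreordMap T A' (fun x => x) hm); split.
  + intros x y; reflexivity.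
  + apply PreordMap_eq; intros x; reflexivity.
Qed.

Lemma trivial_onP (A A' : PreordSet) (B : A -> Prop) (f : PreordMap A A') :
  trivial_on B f <->
  (forall x y : A, B x -> B y -> prel x y -> f x = f y).
Proof.
split.
- intros H x y Bx By Hxy.
  pose proof (proj1 (trivial_morphismP _) (H (ex_intro _ x Bx))) as K.
  exact (K (exist _ x Bx) (exist _ y By) Hxy).
- intros H hB; apply trivial_morphismP; intros [x Bx] [y By] Hxy.
  exact (H x y Bx By Hxy).
Qed.

Lemma stable_rel_refl (A A' : PreordSet) (f : PreordMap A A') : stable_rel f f.
Proof.
exists (fun _ => False); split; [|split; [|split]].
- intros a b _ [].
- intros [a []].
- intros [a []].
- reflexivity.
Qed.

Lemma stable_rel_sym (A A' : PreordSet) (f g : PreordMap A A') :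
  stable_rel f g -> stable_rel g f.
Proof.
intros [B [HB [Hf [Hg H]]]]; exists B; split; [exact HB|].
split; [exact Hg|split; [exact Hf|]].
intros a Ha; symmetry; auto.
Qed.

Lemma clopen_iff (A : PreordSet) (B : A -> Prop) (x y : A) :
  clopen B -> prel x y -> (B x <-> B y).
Proof.
intros HB Hxy; split; intros H; apply NNPP; intros K.
- exact (proj2 (HB y x K H) Hxy).
- exact (proj1 (HB x y K H) Hxy).
Qed.

Lemma stable_rel_trans (A A' : PreordSet) (f g h : PreordMap A A') :
  stable_rel f g -> stable_rel g h -> stable_rel f h.
Proof.
intros [B [HB [Hf [Hg Hfg]]]] [D [HD [Hg' [Hh Hgh]]]].
rewrite trivial_onP in Hf, Hg, Hg', Hh.
exists (fun a => B a \/ D a); split; [|split; [|split]].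
- intros a b Ha Hb; split; intros K;
    pose proof (clopen_iff HB K); pose proof (clopen_iff HD K); tauto.
- apply trivial_onP; intros x y Hx Hy K.
  pose proof (clopen_iff HB K) as EB; pose proof (clopen_iff HD K) as ED.
  destruct (classic (B x)) as [Bx|Bx].
  + apply Hf; tauto.
  + rewrite (Hfg x), (Hfg y) by tauto; apply Hg'; tauto.
- apply trivial_onP; intros x y Hx Hy K.
  pose proof (clopen_iff HB K) as EB; pose proof (clopen_iff HD K) as ED.
  destruct (classic (D x)) as [Dx|Dx].
  + apply Hh; tauto.
  + rewrite <- (Hgh x), <- (Hgh y) by tauto; apply Hg; tauto.
- intros a Ha; rewrite Hfg, Hgh by tauto; reflexivity.
Qed.

Lemma stable_rel_postcomp (A B D : PreordSet) (g : PreordMap B D)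
    (f f' : PreordMap A B) :
  stable_rel f f' -> stable_rel (pcomp g f) (pcomp g f').
Proof.
intros [U [HU [Hf [Hf' H]]]]; rewrite trivial_onP in Hf, Hf'.
exists U; rewrite !trivial_onP; simpl; split; [exact HU|]; repeat split.
- intros x y Ux Uy K; f_equal; auto.
- intros x y Ux Uy K; f_equal; auto.
- intros a Ha; f_equal; auto.
Qed.

Lemma stable_rel_precomp (A B D : PreordSet) (g g' : PreordMap B D)
    (f : PreordMap A B) :
  stable_rel g g' -> stable_rel (pcomp g f) (pcomp g' f).
Proof.
intros [U [HU [Hg [Hg' H]]]]; rewrite trivial_onP in Hg, Hg'.
exists (fun a => U (f a)); rewrite !trivial_onP; simpl.
split; [|split; [|split]].
- intros a b Ha Hb; destruct (HU (f a) (f b) Ha Hb) as [K1 K2].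
  split; intros K; [apply K1|apply K2]; exact (pmap_mono f K).
- intros x y Ux Uy K; apply Hg; auto; exact (pmap_mono f K).
- intros x y Ux Uy K; apply Hg'; auto; exact (pmap_mono f K).
- intros a Ha; auto.
Qed.

Lemma stable_rel_congruence : @congruence Preord stable_rel.
Proof.
split.
- intros A A'; split.
  + exact (@stable_rel_refl A A').
  + exact (@stable_rel_sym A A').
  + exact (@stable_rel_trans A A').
- intros A B D g g' f f' Hg Hf.
  exact (stable_rel_trans (stable_rel_precomp f Hg) (stable_rel_postcomp g' Hf)).
Qed.

Definition StablePreord : Category := Quotient stable_rel_congruence.

(* Main.v *)
Require Import Defs.

(** Any two trivial parallel morphisms become equal in the stable category,
    since the clopen subset in the definition of the congruence may be the whole
    source. Every morphism into or out of a trivial object is trivial, as it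
    factors through that object; and there is always at least one, namely a
    constant map, because objects are non-empty. So each hom-set of the stable
    category into or out of a trivial object has exactly one element. A zero
    object then exists because the one-point set is trivial. *)

Lemma trivial_stable_rel (A A' : PreordSet) (f g : PreordMap A A') :
  trivial_morphism f -> trivial_morphism g -> stable_rel f g.
Proof.
rewrite !trivial_morphismP; intros Hf Hg.
exists (fun _ => True); rewrite !trivial_onP; repeat split; try tauto; auto.
Qed.

Lemma trivial_morphism_from (B X : PreordSet) (f : PreordMap B X) :
  trivial_object B -> trivial_morphism f.
Proof.
intros HB; exists B, (pid B), f; split; [exact HB|].
symmetry; apply pcomp_idr.
Qed.

Lemma trivial_morphism_to (X B : PreordSet) (f : PreordMap X B) :
  trivial_object B -> trivial_morphism f.
Proof.
intros HB; exists B, f, (pid B); split; [exact HB|].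
symmetry; apply pcomp_idl.
Qed.

Definition const_map (A A' : PreordSet) (a : A') : PreordMap A A' :=
  @MkPreordMap A A' (fun _ => a)
    (fun _ _ _ => @RelationClasses.PreOrder_Reflexive _ _ (prel_preorder A') a).

Lemma stable_hom_unique (X Y : PreordSet) :
  (forall f : PreordMap X Y, trivial_morphism f) ->
  exists! F : @Hom StablePreord X Y, True.
Proof.
intros Htriv; destruct (carrier_nonempty Y) as [y].
exists (cls (@stable_rel X Y) (const_map X Y y)); split; [exact I|].
intros F _; destruct (quot_surj F) as [f ->].
apply cls_eq; [exact (cong_equiv stable_rel_congruence X Y)|].
apply trivial_stable_rel; apply Htriv.
Qed.

Lemma trivial_zero_object (B : PreordSet) :
  trivial_object B -> @zero_object StablePreord B.
Proof.
intros HB; split; intros X; apply stable_hom_unique; intros f.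
- exact (trivial_morphism_from B X f HB).
- exact (trivial_morphism_to X B f HB).
Qed.

Theorem mainTheorem3 :
  pointed StablePreord /\
  (forall B : Ob Preord, trivial_object B -> @zero_object StablePreord B).
Proof.
split; [|exact trivial_zero_object].
exists (discrete (inhabits tt)); apply trivial_zero_object.
intros x y; reflexivity.
Qed.
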